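(* For every graph $G$ and every odd integer $d\geq 3$, $$\pi(G^{(d)}) \leq \pi(G)^{2/(d-1)} +4.$$
   Context: All graphs are finite, simple and undirected. A path in a graph is a sequence of pairwise distinct vertices, consecutive ones adjacent. Given a vertex colouring $\phi$, a sequence $(v_1,\dots,v_{2s})$ is repetitively coloured if $\phi(v_i)=\phi(v_{s+i})$ for all $i\in\{1,\dots,s\}$; a colouring is nonrepetitive if no path is repetitively coloured. $\pi(G)$ is the minimum number of colours in a nonrepetitive colouring of $G$. For an integer $d\ge 0$, $G^{(d)}$ denotes the $d$-subdivision of $G$: each edge $vw$ is replaced by a path from $v$ to $w$ with exactly $d$ internal vertices, these paths being internally disjoint. *)

(* Defs.v *)
From HB Require Import structures.
From mathcomp Require Import all_boot all_order all_algebra.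
From mathcomp Require Import boolp reals exp.

Set Implicit Arguments.
Unset Strict Implicit.
Unset Printing Implicit Defensive.

Record sgraph := SGraph {
  vertex :> finType;
  adj : rel vertex;
  adj_sym : symmetric adj;
  adj_irr : irreflexive adj
}.

Definition is_path (G : sgraph) (p : seq G) : bool :=
  uniq p && sorted (@adj G) p.

Definition repetitively_coloured (G : sgraph) (C : Type) (phi : G -> C)
    (p : seq G) : Prop :=
  exists s : nat,
    [/\ 0 < s, size p = 2 * s &
        forall i, i < s -> onth (map phi p) i = onth (map phi p) (s + i)].

Definition nonrepetitive (G : sgraph) (C : Type) (phi : G -> C) : Prop :=
  forall p : seq G, is_path p -> ~ repetitively_coloured phi p.

Definition nonrep_colourable (G : sgraph) (k : nat) : Prop :=
  exists phi : G -> 'I_k, nonrepetitive phi.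

Lemma inj_nonrepetitive (G : sgraph) (C : Type) (phi : G -> C) :
  injective phi -> nonrepetitive phi.
Proof.
move=> inj p /andP[up _] [s [s_gt0 sz rep]].
have := rep 0 s_gt0; rewrite addn0 !onth_map => /(inj_omap inj) E.
have lt0 : minn s 0 < size p by rewrite minn0 sz muln_gt0.
have s0 : 0 = s by apply: onth_inj up lt0 E.
by move: s_gt0; rewrite -s0.
Qed.

Lemma nonrep_colourable_card (G : sgraph) :
  exists k, `[< nonrep_colourable G k >].
Proof.
exists #|G|; apply/asboolP; exists (@enum_rank G).
exact: inj_nonrepetitive enum_rank_inj.
Qed.

(* The nonrepetitive chromatic number, written \pi(G) in the literature. *)
Definition nonrep_number (G : sgraph) : nat :=
  ex_minn (nonrep_colourable_card G).

(* Each edge vw occurs exactly once here, oriented along the enumeration of G;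
   the orientation only fixes which end of the subdivided path is numbered 0. *)
Definition edge (G : sgraph) : finType :=
  {e : G * G | adj e.1 e.2 && (enum_rank e.1 < enum_rank e.2)}.

Definition subdiv_vertex (G : sgraph) (d : nat) : finType :=
  (G + edge G * 'I_d)%type.

(* inr (e, i) is the (i+1)-st internal vertex of the path replacing e, so that
   path is inl (val e).1, inr (e, 0), ..., inr (e, d-1), inl (val e).2. *)
Definition end_adj (G : sgraph) (d : nat) (v : G) (e : edge G)
    (i : 'I_d) : bool :=
  (v == (val e).1) && (i == 0 :> nat) || (v == (val e).2) && (i.+1 == d).

Definition subdiv_adj (G : sgraph) (d : nat) : rel (subdiv_vertex G d) :=
  fun x y =>
  match x, y with
  | inl v, inl w => (d == 0) && adj v w
  | inl v, inr (e, i) => end_adj v e i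
  | inr (e, i), inl v => end_adj v e i
  | inr (e, i), inr (f, j) =>
      (e == f) && ((j == i.+1 :> nat) || (i == j.+1 :> nat))
  end.

Lemma subdiv_adj_sym (G : sgraph) (d : nat) : symmetric (@subdiv_adj G d).
Proof.
move=> [v|[e i]] [w|[f j]] //=; first by rewrite adj_sym.
by rewrite eq_sym orbC.
Qed.

Lemma subdiv_adj_irr (G : sgraph) (d : nat) : irreflexive (@subdiv_adj G d).
Proof.
move=> [v|[e i]] /=; first by rewrite adj_irr andbF.
by rewrite eqxx orbb -[_ == _]negbK neq_ltn ltnSn.
Qed.

Definition subdivision (G : sgraph) (d : nat) : sgraph :=
  SGraph (@subdiv_adj_sym G d) (@subdiv_adj_irr G d).

(* Main.v *)
Require Import Defs.
From mathcomp Require Import all_boot all_order all_algebra.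
From mathcomp Require Import boolp reals exp.
From mathcomp Require Import zify.

(** Write d = 2t + 1 and k = \pi(G), and let m be the least integer with
    k <= m ^ t; since m - 1 < k ^ (1/t), it suffices to use m + 3 colours.

    Encode the k colours of a nonrepetitive colouring of G injectively as
    squarefree words of length t. Write the word of v on the t subdivision
    vertices next to v along each edge at v, read away from v, and give the
    original vertices and the middle vertices of the edges separator colours.
    In a repetitively coloured path the separators, which are t + 1 apart, and
    squarefreeness force the period to be a multiple of t + 1. If it is an even
    multiple, each original vertex in the first half has all of its word on one
    of its two sides inside that half, so the original vertices form a
    repetitively coloured path of G.

    Odd multiples would match original vertices with middle ones. They are
    excluded either by two distinct separator colours, leaving m + 1 letters, or
    by a single separator colour and words whose first letter is smaller than
    their last one, leaving m + 2 letters. Counting squarefree words shows that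
    m + 1 letters suffice for t <= m + 1, and m + 2 letters for t >= m + 2. *)

Set Implicit Arguments.
Unset Strict Implicit.
Unset Printing Implicit Defensive.

(** * Squarefree words *)

Section Squarefree.
Variable T : eqType.
Implicit Types w : seq T.

Definition square_prefix w :=
  has (fun j => take j w == take j (drop j w)) (iota 1 (size w)./2).

Fixpoint squarefree w :=
  if w is a :: w' then ~~ square_prefix w && squarefree w' else true.

Lemma eq_take_dropP x0 w i j : i + 2 * j <= size w ->
  reflect (forall l, l < j -> nth x0 w (i + l) = nth x0 w (i + j + l))
          (take j (drop i w) == take j (drop (i + j) w)).
Proof.
move=> le_ij; apply: (iffP eqP) => [eqw l lt_lj|eqw].
  by rewrite -!nth_drop -(nth_take x0 lt_lj) eqw nth_take.
apply: (@eq_from_nth _ x0) => [|l]; first by rewrite !size_takel ?size_drop; lia.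
rewrite size_takel ?size_drop; last lia.
by move=> lt_lj; rewrite !nth_take // !nth_drop eqw.
Qed.

Lemma squarefreeP x0 w :
  reflect (forall i j, 0 < j -> i + 2 * j <= size w ->
             ~ forall l, l < j -> nth x0 w (i + l) = nth x0 w (i + j + l))
          (squarefree w).
Proof.
apply: (iffP idP) => [|sfw].
  elim: w => [_ i j|a w IHw /andP[/hasPn nsq sfw] [|i] j j_gt0 le_ij];
    first by move=> ? /=; lia.
    move/(eq_take_dropP x0 le_ij); rewrite add0n drop0; apply/negP/nsq.
    by rewrite mem_iota j_gt0 /=; move: le_ij => /=; lia.
  by apply: (IHw sfw) => //; move: le_ij => /=; lia.
elim: w sfw => // a w IHw sfw; apply/andP; split; last first.
  by apply: IHw => i j j_gt0 le_ij; apply: (sfw i.+1 j).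
apply/hasPn => j; rewrite mem_iota => /andP[j_gt0 le_j].
have le_j' : 0 + 2 * j <= size (a :: w) by move: le_j => /=; lia.
by apply/negP=> /eqP eqw; apply: (sfw 0 j) => //; apply/(eq_take_dropP x0 le_j');
  rewrite drop0 add0n eqw.
Qed.

Lemma squarefree_rev w : squarefree w -> squarefree (rev w).
Proof.
case: w => // a w /(squarefreeP a) sfw; apply/(squarefreeP a) => i j j_gt0.
set u := a :: w in sfw *; rewrite size_rev => le_ij eqw.
(* The mirrored square starts at [size u - i - 2 * j], with its halves exchanged. *)
apply: (sfw (size u - i - 2 * j) j) => //; first lia.
move=> l lt_lj; have := eqw (j - l.+1) ltac:(lia).
rewrite !nth_rev; try lia.
by move=> /esym; congr (nth _ _ _ = nth _ _ _); lia.
Qed.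

Lemma squarefree_drop i w : squarefree w -> squarefree (drop i w).
Proof. by elim: w i => [|a w IHw] [|i] //= /andP[_ /IHw]. Qed.

End Squarefree.

(** * Counting squarefree words by length *)

Lemma count_has_leq (I T : Type) (P : I -> pred T) (r : seq I) (s : seq T) :
  count (fun x => has (P^~ x) r) s <= \sum_(i <- r) count (P i) s.
Proof.
elim: r => [|i r IHr] /=; first by rewrite big_nil (@eq_count _ _ pred0) ?count_pred0.
rewrite big_cons (leq_trans _ (leq_add (leqnn _) IHr)) //.
by rewrite -count_predUI leq_addr.
Qed.

Section Counting.
Variable n : nat.

Fixpoint sfwords t : seq (seq 'I_n) :=
  if t is t'.+1 then
    [seq w <- [seq a :: w | a <- enum 'I_n, w <- sfwords t'] | ~~ square_prefix w]
  else [:: [::]].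

Lemma mem_sfwords t w : (w \in sfwords t) = (size w == t) && squarefree w.
Proof.
elim: t w => [|t IHt] [|a w] //; first by rewrite mem_filter;
  apply/negbTE/negP => /andP[_ /allpairsP[[? ?] []]].
rewrite mem_filter /= eqSS [RHS]andbCA; congr (_ && _).
apply/allpairsP/andP => [[[b u] /= [_ + [_ ->]]]|[szw sfw]]; first by rewrite IHt => /andP.
by exists (a, w); rewrite mem_enum IHt /= szw sfw.
Qed.

Lemma uniq_sfword_extensions t : uniq (sfwords t) ->
  uniq [seq a :: w | a <- enum 'I_n, w <- sfwords t].
Proof.
move=> Ut; apply: allpairs_uniq => //; first exact: enum_uniq.
by move=> [a w] [b u] _ _ [-> ->].
Qed.

Lemma sfwords_uniq t : uniq (sfwords t).
Proof. by elim: t => // t IHt; rewrite filter_uniq ?uniq_sfword_extensions. Qed.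

Definition nsf t := size (sfwords t).

Lemma nsf1 : nsf 1 = n.
Proof.
by rewrite /nsf size_filter (@eq_in_count _ _ predT) ?count_predT ?size_allpairs ?size_enum_ord ?muln1 //
  => _ /allpairsP[[a w] /= [_ + ->]]; rewrite inE => /eqP ->.
Qed.

Lemma count_square_leq j t (s : seq (seq 'I_n)) : 0 < j -> uniq s ->
    {in s, forall w, size w = t.+1 /\ squarefree (behead w)} ->
  count (fun w => take j w == take j (drop j w)) s <= nsf (t.+1 - j).
Proof.
move=> j_gt0 Us sP; rewrite -size_filter -(size_map (drop j)); apply: uniq_leq_size.
  rewrite map_inj_in_uniq ?filter_uniq // => u w.
  rewrite !mem_filter => /andP[/eqP eu _] /andP[/eqP ew _] equ.
  by rewrite -(cat_take_drop j u) -(cat_take_drop j w) eu ew equ.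
move=> _ /mapP[w + ->]; rewrite mem_filter => /andP[_ /sP[szw sfw]].
rewrite mem_sfwords size_drop szw eqxx /=.
by rewrite -(prednK j_gt0) -drop1 in sfw *; have := squarefree_drop j.-1 sfw;
  rewrite drop_drop addn1.
Qed.

(* A word [a :: w] with [w] squarefree that has a square has one as a prefix,
   and it can then be recovered from what is left after deleting one half of it. *)
Lemma nsf_rec t :
  n * nsf t <= nsf t.+1 + \sum_(1 <= j < (t.+1)./2.+1) nsf (t.+1 - j).
Proof.
set s := [seq a :: w | a <- enum 'I_n, w <- sfwords t].
have sP : {in s, forall w, size w = t.+1 /\ squarefree (behead w)}.
  by move=> _ /allpairsP[[a w] /= [_ + ->]]; rewrite mem_sfwords => /andP[/eqP <-].
have Us : uniq s by apply/uniq_sfword_extensions/sfwords_uniq.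
have -> : n * nsf t = size s by rewrite size_allpairs size_enum_ord.
rewrite -(count_predC (@square_prefix _)) addnC /nsf /= size_filter leq_add2l.
rewrite (@eq_in_count _ _ (fun w => has (fun j => take j w == take j (drop j w))
  (iota 1 (t.+1)./2))); last by move=> w /sP[szw _]; rewrite /square_prefix szw.
apply: leq_trans (count_has_leq _ _ _) _; rewrite /index_iota subSS subn0.
rewrite !big_seq; apply: leq_sum => j; rewrite mem_iota => /andP[j_gt0 _].
exact: count_square_leq.
Qed.

(** Enlarging the loss to all lengths from 2 to [t] makes it gain a single term when [t] grows by
    one, which suits induction. *)
Lemma nsf_sum_rec t : 1 < t -> n * nsf t <= nsf t.+1 + \sum_(2 <= i < t.+1) nsf i.
Proof.
move=> t_gt1; apply: leq_trans (nsf_rec t) _; rewrite leq_add2l.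
have le_t : (t.+1)./2.+1 <= t by lia.
have -> : \sum_(2 <= i < t.+1) nsf i = \sum_(1 <= j < t) nsf (t.+1 - j).
  rewrite big_add1 big_nat_rev /=; apply: eq_big_nat => j ?; congr nsf; lia.
by rewrite [leqRHS](big_cat_nat (n := (t.+1)./2.+1)) ?leq_addr.
Qed.

Lemma nsf2_geq : n * n <= nsf 2 + n.
Proof. by have := nsf_rec 1; rewrite big_nat1 nsf1. Qed.

(** Doubling the first letter of a squarefree word gives an extension with a square, so at least
    [nsf t] extensions are lost. *)
Lemma nsfS_leq t : 0 < t -> nsf t.+1 + nsf t <= n * nsf t.
Proof.
move=> t_gt0; set s := [seq a :: w | a <- enum 'I_n, w <- sfwords t].
have -> : n * nsf t = size s by rewrite size_allpairs size_enum_ord.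
rewrite -(count_predC (@square_prefix _)) addnC /nsf /= size_filter leq_add2r.
pose dup (w : seq 'I_n) := take 1 w ++ w.
rewrite -size_filter -(size_map dup); apply: uniq_leq_size.
  rewrite map_inj_in_uniq ?sfwords_uniq // => u w.
  rewrite !mem_sfwords => /andP[/eqP su _] /andP[/eqP sw _].
  by case: u w su sw t_gt0 => [|a u] [|b w] <- // _ _; rewrite /dup /= !take0 => -[-> _ ->].
move=> _ /mapP[[|a w] + ->]; rewrite mem_sfwords => /andP[/= /eqP szw sfw].
  by move: szw t_gt0 => <-.
rewrite mem_filter; apply/andP; split;
  first by rewrite /square_prefix /dup /= !take0 /= take0 eqxx.
by apply/allpairsP; exists (a, a :: w); rewrite mem_enum mem_sfwords /dup /= take0 szw eqxx.
Qed.

(* Words that tell their two ends apart, so that no one of them is the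
   reversal of another. *)
Definition oriented (x0 : 'I_n) (w : seq 'I_n) := head x0 w < last x0 w.

(** Reversal pairs the oriented words with those whose end letters decrease. A word with equal ends
    is recovered from its tail, a squarefree word of length [t.+1]. *)
Lemma count_oriented_geq x0 t :
  nsf t.+2 <= 2 * count (oriented x0) (sfwords t.+2) + nsf t.+1.
Proof.
rewrite [nsf t.+2]/nsf.
move: (sfwords t.+2) (sfwords_uniq t.+2) (@mem_sfwords t.+2) => s Us sE.
have cntR : count (oriented x0 \o rev) s = count (oriented x0) s.
  have srev w : w \in s -> rev w \in s.
    by rewrite !sE size_rev => /andP[-> /squarefree_rev].
  rewrite -count_map; apply/permP/uniq_perm => // [|w].
    by rewrite map_inj_uniq //; apply: inv_inj revK.
  apply/mapP/idP => [[u us ->]|/srev ws]; first exact: srev.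
  by exists (rev w); rewrite ?revK.
have cntE : count (fun w => head x0 w == last x0 w) s <= nsf t.+1.
  rewrite -size_filter -(size_map behead); apply: uniq_leq_size.
    rewrite map_inj_in_uniq ?filter_uniq // => u w.
    rewrite !mem_filter !sE => /and3P[eu su _] /and3P[ew sw _].
    case: u w eu su ew sw => [|a [|b u]] [|c [|d w]] //=.
    by move=> /eqP -> _ /eqP -> _ [-> ->].
  move=> _ /mapP[[|a w] + ->]; rewrite mem_filter sE mem_sfwords ?andbF /= ?andbF // eqSS.
  by case/and4P => _ -> _ ->.
pose P := [:: oriented x0; oriented x0 \o rev; fun w => head x0 w == last x0 w].
apply: leq_trans (_ : \sum_(p <- P) count p s <= _); last first.
  by rewrite !big_cons big_nil cntR; lia.
rewrite -count_predT; apply: leq_trans (count_has_leq (fun p w => p w) P s).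
apply: sub_count => w _ /=; rewrite /oriented /=.
have hd (u : seq 'I_n) : head x0 (rev u) = last x0 u.
  by case/lastP: u => // u a; rewrite rev_rcons last_rcons.
have -> : last x0 (rev w) = head x0 w by rewrite -hd revK.
by rewrite hd -val_eqE /=; lia.
Qed.

End Counting.

(** * Growth of the number of squarefree words *)

Section Growth.
Variable m : nat.
Hypothesis m_gt1 : 1 < m.

Lemma nsf_leq t : nsf m.+1 t.+1 <= m.+1 * m ^ t.
Proof.
elim: t => [|t IHt]; first by rewrite nsf1 expn0; lia.
have := @nsfS_leq m.+1 t.+1 isT; rewrite expnS; nia.
Qed.

Lemma sum_nsf_leq t : \sum_(2 <= i < t.+2) m.-1 * nsf m.+1 i <= m.+1 * m ^ t.+1.
Proof.
elim: t => [|t IHt]; first by rewrite big_geq.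
rewrite big_nat_recr //=; have := leq_mul (leqnn m.-1) (nsf_leq t.+1).
move: IHt; rewrite !(expnS _ t.+1); move: (\sum_(_ <= _ < _) _) (nsf _ _) (m ^ t.+1) => P S e.
by case: m m_gt1 => [|p] //= _; nia.
Qed.

Lemma nsf3_geq n : n.+1 * n ^ 2 <= nsf n.+1 3.
Proof.
have := nsf2_geq n.+1; have := @nsf_sum_rec n.+1 2 isT; rewrite big_nat1; nia.
Qed.

(* The loss from squares of period at least 2 is compared with the surplus
   [m ^ (t - 1)] of [m.+1 * m ^ (t - 1)] over [m ^ t]. *)
Lemma nsf_geq_deficit i :
  m.-1 * (m.+1 * m ^ i.+2) <= m.-1 * nsf m.+1 (3 + i) + i * (m.+1 * m ^ i.+1).
Proof.
elim: i => [|i IHi]; first by have := nsf3_geq m; rewrite addn0 mul0n addn0; nia.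
(* The last summand, the loss from period 1, lowers the factor [m.+1] to [m]; only the remaining sum
   adds to the deficit. *)
have := @nsf_sum_rec m.+1 (3 + i) isT; rewrite big_nat_recr //=.
have := sum_nsf_leq i.+1; rewrite -big_distrr /= addnS.
set P := \sum_(_ <= _ < _) _; set S := nsf _ (3 + i) in IHi *; set S' := nsf _ _ => hP hS.
move: IHi hP hS; rewrite !(expnS _ i.+2) !(expnS _ i.+1).
move: (m ^ i.+1) P S S' => e P S S'; case: m m_gt1 => [|p] //= _ IHi hP hS.
have : p * (p.+2 * S) <= p * (S' + (P + S)) by rewrite leq_mul2l hS orbT.
nia.
Qed.

Lemma nsf_geq_short t : 0 < t <= m.+1 -> m ^ t <= nsf m.+1 t.
Proof.
case: t => [|[|[|i]]] // /andP[_ le_t].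
- by rewrite nsf1 expn1.
- by have := nsf2_geq m.+1; nia.
have := nsf_geq_deficit i; rewrite !addSn add0n.
rewrite !(expnS _ i.+2) !(expnS _ i.+1).
move: (m ^ i.+1) (nsf _ _) => e S le_S.
(* The surplus covers the deficit: [i <= m - 2] and [(m - 2) * (m + 1) <= (m - 1) * m]. *)
have le_i : i * m.+1 * e <= m.-1 * m * e by rewrite leq_mul2r; apply/orP; right; nia.
have : m.-1 * (m * (m * e)) <= m.-1 * S; last by rewrite leq_mul2l; lia.
by case: m m_gt1 le_i le_S => [|p] //= _; nia.
Qed.

(** One induction for all three. A sum within the factor [m / (m - 1)] of its last term, as in a
    geometric series of ratio [m], gives growth by [(m ^ 2 - 2) / (m - 1)], which is at least [m];
    growth by [m] carries the sum bound to the next length. *)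
Lemma nsf_growth t : 1 < t ->
  [/\ m.-1 * \sum_(2 <= i < t.+1) nsf m.+2 i <= m * nsf m.+2 t,
      (m ^ 2 - 2) * nsf m.+2 t <= m.-1 * nsf m.+2 t.+1 &
      m * nsf m.+2 t <= nsf m.+2 t.+1].
Proof.
have step t' : 1 < t' -> m.-1 * \sum_(2 <= i < t'.+1) nsf m.+2 i <= m * nsf m.+2 t' ->
    (m ^ 2 - 2) * nsf m.+2 t' <= m.-1 * nsf m.+2 t'.+1 /\
    m * nsf m.+2 t' <= nsf m.+2 t'.+1.
  move=> /(nsf_sum_rec m.+2);
    move: (nsf _ t') (nsf _ t'.+1) (\sum_(_ <= _ < _) _) => S S' P hS hP.
  have : m.-1 * (m.+2 * S) <= m.-1 * (S' + P) by rewrite leq_mul2l hS orbT.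
  case: m m_gt1 hP {hS} => [|p] //= p_gt0 hP hS.
  have h1 : (p.+1 ^ 2 - 2) * S <= p * S' by rewrite mulnBl; nia.
  split=> //; suff : p * (p.+1 * S) <= p * S' by rewrite leq_mul2l; lia.
  apply: leq_trans h1; rewrite mulnA leq_mul2r; nia.
case: t => [|[|t]] // _; elim: t => [|t [IH1 IH2 IH3]].
  have h : m.-1 * \sum_(2 <= i < 3) nsf m.+2 i <= m * nsf m.+2 2.
    by rewrite big_nat1 leq_mul2r leq_pred orbT.
  by have [] := step 2 isT h.
have h : m.-1 * \sum_(2 <= i < t.+4) nsf m.+2 i <= m * nsf m.+2 t.+3.
  rewrite big_nat_recr //= mulnDr; move: IH1 IH3.
  move: (\sum_(_ <= _ < _) _) (nsf _ _) (nsf _ _) => P S S'.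
  by case: m m_gt1 => [|p] //= _; nia.
by have [] := step t.+3 isT h.
Qed.

(* Bernoulli's inequality for the growth factor [m + (m - 2) / (m - 1)] of
   [nsf_growth]. *)
Lemma nsf_geq_bernoulli i :
  m.+2 * m.+1 ^ 2 * m ^ i * (m * m.-1 + i * (m - 2)) <= m * m.-1 * nsf m.+2 (3 + i).
Proof.
elim: i => [|i IHi].
  by have := nsf3_geq m.+1; rewrite expn0 muln1 mul0n !addn0; nia.
have [_ + _] := @nsf_growth (3 + i) isT; rewrite addnS (expnS m i).
move: IHi; move: (_ * _ ^ 2) (m ^ i) (nsf _ _) (nsf _ _) => c e S' S.
case: m m_gt1 => [|[|p]] //= _; rewrite (_ : p.+2 - 2 = p) => [IHi hS|]; last lia.
have {}hS : p.+2 * ((p.+2 ^ 2 - 2) * S) <= p.+2 * (p.+1 * S') by rewrite leq_mul2l hS orbT.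
suff : p.+1 * (c * (p.+2 * e) * (p.+2 * p.+1 + i.+1 * p)) <= p.+1 * (p.+2 * p.+1 * S').
  by rewrite leq_mul2l.
rewrite [leqRHS](_ : _ = p.+1 * (p.+2 * (p.+1 * S'))); last by lia.
apply: leq_trans (leq_mul (leqnn _) hS).
rewrite [leqRHS](_ : _ = (p.+2 ^ 2 - 2) * (p.+2 * p.+1 * S)); last by lia.
apply: leq_trans (leq_mul (leqnn _) IHi).
have -> : p.+2 ^ 2 - 2 = p * p + 4 * p + 2 by lia.
rewrite [leqLHS](_ : _ = c * e * (p.+1 * p.+2 * (p.+2 * p.+1 + i.+1 * p))); last by lia.
rewrite [leqRHS](_ : _ = c * e * ((p * p + 4 * p + 2) * (p.+2 * p.+1 + i * p))); last by lia.
by rewrite leq_mul2l; apply/orP; right; nia.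
Qed.

(** The Bernoulli bound at [i = m - 1] settles [t = m + 2], and growth by [m] does the rest. The
    constant leaves room for the words with equal ends, at most a fraction [1 / m], and for the
    halving by orientation. *)
Lemma nsf_geq_long t : m.+1 < t -> 2 * m ^ t.+1 <= m.-1 * nsf m.+2 t.
Proof.
move=> lt_mt; rewrite -(subnK lt_mt); elim: (t - m.+2) => [|i IHi].
  have := nsf_geq_bernoulli m.-1.
  have -> : 3 + m.-1 = 0 + m.+2 by lia.
  move: (nsf _ _) => S; case: m m_gt1 => [|[|p]] //= _; rewrite (_ : p.+2 - 2 = p) ?add0n;
    last lia.
  rewrite (_ : p.+4.+1 = p.+1 + 4) ?expnD; last lia.
  move: (p.+2 ^ p.+1) => e h.
  suff : p.+2 * p.+1 * (2 * (e * p.+2 ^ 4)) <= p.+2 * p.+1 * (p.+1 * S).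
    by rewrite leq_mul2l.
  have := leq_mul (leqnn p.+1) h.
  move=> {}h; apply: leq_trans (_ : p.+1 * (p.+2 * p.+1 * S) <= _); last lia.
  apply: leq_trans h.
  rewrite [leqLHS](_ : _ = p.+1 * (e * (2 * p.+2 ^ 5))); last by lia.
  rewrite [leqRHS](_ : _ = p.+1 * (e * (p.+4 * p.+3 ^ 2 * (p.+2 * p.+1 + p.+1 * p))));
    last by lia.
  (* With [m = p + 2], what remains is twice [m ^ 5 <= (m + 2) * (m ^ 2 - 1) ^ 2], true from [m = 2]
     on. *)
  by rewrite !leq_mul2l; apply/orP; right; apply/orP; right; nia.
have [_ _ h] := @nsf_growth (i + m.+2) ltac:(lia).
rewrite addSn expnS; have := leq_mul (leqnn m) IHi.
have := leq_mul (leqnn m.-1) h; lia.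
Qed.

Lemma count_oriented_geq_long (x0 : 'I_m.+2) t : m.+1 < t ->
  m ^ t <= count (oriented x0) (sfwords m.+2 t).
Proof.
case: t => [|[|t]] // lt_mt; have [_ _ h1] := @nsf_growth t.+1 ltac:(lia).
have := count_oriented_geq x0 t; have := nsf_geq_long lt_mt; rewrite expnS.
move: (count _ _) (nsf _ _) (nsf _ _) (m ^ t.+2) h1 => c S S' e h1 h2 h3.
have h4 := leq_mul (leqnn m) h3.
suff : 2 * m * e <= 2 * m * c by rewrite leq_mul2l; lia.
case: m m_gt1 h1 h2 h4 => [|p] //= _; nia.
Qed.

End Growth.

(** * Paths in a subdivision *)

Section SubdivisionPaths.
Variables (G : sgraph) (d : nat).
Hypothesis d_gt0 : 0 < d.
Implicit Types (u v w : G) (x y z : subdivision G d) (e f : edge G).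

(** An edge is stored in one orientation only, hence the backward reading [j + i == d] for [(w, v)].
    Being a relation, it makes sense before [v] and [w] are known to be adjacent. *)
Definition on_edge v w (j : nat) x : bool :=
  match x : subdiv_vertex G d with
  | inl u => (j == 0) && (u == v) || (j == d.+1) && (u == w)
  | inr (e, i) => (val e == (v, w)) && (j == i.+1) || (val e == (w, v)) && (j + i == d)
  end.

Lemma on_edge_sym v w j x : j <= d.+1 -> on_edge v w j x = on_edge w v (d.+1 - j) x.
Proof.
move=> le_jd; case: x => [u|[e i]] /=.
  have -> : (d.+1 - j == 0) = (j == d.+1) by lia.
  have -> : (d.+1 - j == d.+1) = (j == 0) by lia.
  by rewrite orbC.
have lt_id := ltn_ord i.
have -> : (d.+1 - j == i.+1) = (j + i == d) by lia.
have -> : (d.+1 - j + i == d) = (j == i.+1) by lia.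
by rewrite orbC.
Qed.

Lemma on_edge0 v w x : on_edge v w 0 x = (x == inl v).
Proof.
case: x => [u|[e i]] /=; first by rewrite orbF.
have lt_id := ltn_ord i; have -> : (0 + i == d) = false by lia.
by rewrite !andbF.
Qed.

Lemma on_edge_end v w x : on_edge v w d.+1 x = (x == inl w).
Proof. by rewrite on_edge_sym // subnn on_edge0. Qed.

Lemma edge_val_swap e f v w : val e = (v, w) -> val f <> (w, v).
Proof.
move=> ev fv; have /andP[_] := valP e; have /andP[_] := valP f.
by rewrite ev fv /=; lia.
Qed.

Lemma on_edge_inj v w j x y : on_edge v w j x -> on_edge v w j y -> x = y.
Proof.
case: x y => [a|[e i]] [b|[f k]] /=; try (have := ltn_ord i); try (have := ltn_ord k).
- by case/orP=> /andP[/eqP -> /eqP ->] /orP[]/andP[? /eqP ->].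
- by move=> ? /orP[]/andP[? _] /orP[]/andP[_ ?]; lia.
- by move=> ? /orP[]/andP[_ ?] /orP[]/andP[? _]; lia.
move=> ? ? /orP[]/andP[/eqP ev ?] /orP[]/andP[/eqP fv ?].
- by congr inr; congr pair; apply: val_inj => /=; [rewrite ev fv|lia].
- by case: (edge_val_swap ev fv).
- by case: (edge_val_swap fv ev).
- by congr inr; congr pair; apply: val_inj => /=; [rewrite ev fv|lia].
Qed.

Lemma adj_on_edge x y : adj x y ->
  exists v w j, [/\ adj v w, j <= d, on_edge v w j x & on_edge v w j.+1 y].
Proof.
have Eadj e : adj (val e).1 (val e).2 by have /andP[] := valP e.
have Eadj' e : adj (val e).2 (val e).1 by rewrite adj_sym.
have valE e : val e == ((val e).1, (val e).2) by rewrite -surjective_pairing.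
case: x y => [a|[e i]] [b|[f k]] /=.
- by rewrite eqn0Ngt d_gt0.
- rewrite /end_adj; have := ltn_ord k => ? /orP[]/andP[/eqP -> /eqP k0].
    by exists (val f).1, (val f).2, 0; rewrite /= ?Eadj ?Eadj' !eqxx valE k0.
  by exists (val f).2, (val f).1, 0; rewrite /= ?Eadj ?Eadj' !eqxx valE add1n k0 eqxx ?orbT.
- rewrite /end_adj; have := ltn_ord i => ? /orP[]/andP[/eqP -> /eqP i0].
    by exists (val e).2, (val e).1, d; rewrite /= ?Eadj ?Eadj' !eqxx valE i0 addn0 eqxx ?orbT.
  by exists (val e).1, (val e).2, d; rewrite /= ?Eadj ?Eadj' !eqxx valE i0 eqxx ?orbT.
case/andP=> /eqP <-; have := ltn_ord i; have := ltn_ord k => ? ? /orP[]/eqP ik.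
  exists (val e).1, (val e).2, i.+1; rewrite Eadj valE /= ik !eqxx; split=> //.
exists (val e).2, (val e).1, (d - i); rewrite Eadj' valE /=.
have -> : d - i + i == d by lia.
have -> : (d - i).+1 + k == d by lia.
by rewrite !orbT leq_subr.
Qed.

Lemma on_edge_nbr v w j x y : 0 < j <= d -> on_edge v w j y -> adj x y ->
  on_edge v w j.-1 x \/ on_edge v w j.+1 x.
Proof.
case: y => [b|[f k]] j_bd /=; first by move=> /orP[]/andP[? _]; lia.
have := ltn_ord k => ?; case: x => [a|[e i]] /=.
  rewrite /end_adj /= => /orP[]/andP[/eqP -> /eqP kj] /= /orP[]/andP[/eqP -> /eqP k0].
  - by left; rewrite eqxx kj k0.
  - by right; rewrite eqxx kj k0 eqxx ?orbT.
  - by right; rewrite eqxx andbT; lia.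
  - by left; rewrite eqxx; have -> : j.-1 == 0 by lia.
have := ltn_ord i => ? + /andP[/eqP -> ik].
case/orP=> /andP[-> jk]; case/orP: ik => ik.
- by left; have -> : j.-1 == i.+1 by lia.
- by right; have -> : j.+1 == i.+1 by lia.
- by right; apply/orP; right; lia.
- by left; apply/orP; right; lia.
Qed.

(* [traces V o p]: the path p starts at distance o from V 0 on the subdivided
   edge from V 0 to V 1 and then runs along the subdivided walk V 0, V 1, ... *)
Definition traces (V : nat -> G) (o : nat) (p : seq (subdivision G d)) :=
  forall i x, i < size p ->
    on_edge (V ((i + o) %/ d.+1)) (V ((i + o) %/ d.+1).+1) ((i + o) %% d.+1) (nth x p i)
    /\ (i.+1 < size p -> adj (V ((i + o) %/ d.+1)) (V ((i + o) %/ d.+1).+1)).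

Lemma traces2 v w j x y : adj v w -> j <= d -> on_edge v w j x -> on_edge v w j.+1 y ->
  traces (fun q => if q is 0 then v else w) j [:: x; y].
Proof.
move=> vw le_jd jx jy [|[|i]] z //= _.
  by rewrite add0n divn_small ?modn_small.
rewrite add1n; split=> //; case: (ltnP j d) => [lt_jd|le_dj].
  by rewrite divn_small ?modn_small.
have {le_dj} jd : j = d by lia.
by rewrite jd divnn modnn on_edge0 -(on_edge_end v) -{1}jd.
Qed.

Lemma traces_cons x V o p : 0 < o <= d -> on_edge (V 0) (V 1) o.-1 x -> adj (V 0) (V 1) ->
  traces V o p -> traces V o.-1 (x :: p).
Proof.
move=> o_bd ox V01 trp [|i] z //= lt_ip.
  by rewrite add0n divn_small ?modn_small; try lia.
by rewrite addSn -addnS prednK; [apply: trp|lia].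
Qed.

Lemma traces_cons0 x V p w : adj w (V 0) -> on_edge w (V 0) d x ->
  traces V 0 p -> traces (fun q => if q is q'.+1 then V q' else w) d (x :: p).
Proof.
move=> wV dx trp [|i] z //= lt_ip.
  by rewrite add0n divn_small ?modn_small.
rewrite addSn -addnS divnDr ?dvdnn // divnn addn1 modnDr.
by have := trp i z lt_ip; rewrite addn0.
Qed.

(** Induction, extending the path at its front. In front of an original vertex the new vertex opens
    a new edge; otherwise it stays on the same edge, where turning back would repeat a vertex. *)
Lemma is_path_traces p : is_path p -> 1 < size p ->
  exists V o, o <= d /\ traces V o p.
Proof.
case: p => [|x [|y p]] //; elim: p x y => [|z p IHp] x y.
  case/andP=> _; rewrite /sorted /= andbT => /adj_on_edge[v [w [j [vw le_jd jx jy]]]] _.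
  by exists (fun q => if q is 0 then v else w), j; split=> //; apply: traces2.
case/andP=> /andP[xNp Up] /andP[xy pp] _.
have [V [o [le_od trp]]] := IHp y z (introT andP (conj Up pp)) isT.
have [/= oy /(_ isT) V01] := trp 0 x isT; have [oz _] := trp 1 x isT.
rewrite add0n divn_small // modn_small // in oy V01.
(* When [o = d], [z] is an original vertex: distance [d.+1] on this edge is distance 0 on the
   next. *)
have {}oz : on_edge (V 0) (V 1) o.+1 z.
  case: (ltnP o d) => [lt_od|le_do].
    by rewrite add1n divn_small // modn_small in oz.
  have od : o = d by lia.
  by rewrite od on_edge_end; rewrite od add1n divnn modnn on_edge0 in oz.
case: (posnP o) => [o0|o_gt0].
  have [v [w [j [vw le_jd jx jy]]]] := adj_on_edge xy.
  move: oy; rewrite o0 on_edge0 => /eqP ey.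
  move: jy; rewrite {1}ey /= => /andP[/eqP[jd] /eqP wV]; subst j w.
  exists (fun q => if q is q'.+1 then V q' else v), d; split=> //.
  by apply: traces_cons0 => //; rewrite o0 in trp.
exists V, o.-1; split; first lia.
apply: traces_cons => //; first by rewrite o_gt0.
have [//|ox] := on_edge_nbr (introT andP (conj o_gt0 le_od)) oy xy.
by move: xNp; rewrite (on_edge_inj ox oz) !inE eqxx orbT.
Qed.


End SubdivisionPaths.

(** * Colouring a subdivision *)

Section Colouring.
Variables (K S : Type) (n t : nat) (sep : bool -> S) (code : K -> seq 'I_n).
Variable x0 : 'I_n.
Hypothesis t_gt0 : 0 < t.
Hypothesis size_code : forall a, size (code a) = t.
Hypothesis squarefree_code : forall a, squarefree (code a).
Hypothesis inj_code : injective code.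
Hypothesis orient : injective sep \/ forall a, oriented x0 (code a).

(* The colour at distance j from the first end of a subdivided edge whose ends
   are coloured a and b. *)
Definition edge_colour (a b : K) (j : nat) : S + 'I_n :=
  let h := odd (j %/ t.+1) in let r := j %% t.+1 in
  if r == 0 then inl (sep h)
  else inr (nth x0 (code (if h then b else a)) (if h then t - r else r.-1)).

Lemma edge_colourE a b (h : bool) r : r <= t -> edge_colour a b (h * t.+1 + r) =
  if r == 0 then inl (sep h)
  else inr (nth x0 (code (if h then b else a)) (if h then t - r else r.-1)).
Proof.
move=> le_rt; rewrite /edge_colour divnMDl // divn_small // modnMDl modn_small //.
by rewrite addn0; case: h.
Qed.

(** This makes the colouring independent of the direction in which an edge is stored or
    traversed. *)
Lemma edge_colour_sym a b j : 0 < j <= t.*2.+1 ->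
  edge_colour a b j = edge_colour b a (t.*2.+2 - j).
Proof.
move=> j_bd; case: (ltngtP j t.+1) => [lt_j|gt_j|->].
- have -> : t.*2.+2 - j = true * t.+1 + (t.+1 - j) by lia.
  have {1}-> : j = false * t.+1 + j by lia.
  rewrite !edge_colourE; try lia.
  have -> : (j == 0) = false by lia.
  have -> : (t.+1 - j == 0) = false by lia.
  by congr (inr (nth _ _ _)); lia.
- have -> : t.*2.+2 - j = false * t.+1 + (t.*2.+2 - j) by lia.
  have {1}-> : j = true * t.+1 + (j - t.+1) by lia.
  rewrite !edge_colourE; try lia.
  have -> : (j - t.+1 == 0) = false by lia.
  have -> : (t.*2.+2 - j == 0) = false by lia.
  by congr (inr (nth _ _ _)); lia.
have -> : t.*2.+2 - t.+1 = true * t.+1 + 0 by lia.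
have {1}-> : t.+1 = true * t.+1 + 0 by lia.
by rewrite !edge_colourE.
Qed.

Definition walk_colour (Phi : nat -> K) (N : nat) : S + 'I_n :=
  edge_colour (Phi (N %/ t.*2.+2)) (Phi (N %/ t.*2.+2).+1) (N %% t.*2.+2).

(** * Squares in the colour sequence of a subdivided walk *)

Section Walk.
Variable Phi : nat -> K.
Local Notation wc := (walk_colour Phi).

(** The walk is cut at its separators. Blocks [2q - 1] and [2q] flank the [q]-th original vertex and
    both carry its word, hence [uphalf h]. *)
Lemma walk_colourE h r : r <= t -> wc (h * t.+1 + r) =
  if r == 0 then inl (sep (odd h))
  else inr (nth x0 (code (Phi (uphalf h))) (if odd h then t - r else r.-1)).
Proof.
move=> le_rt; rewrite /walk_colour.
have -> : h * t.+1 + r = h./2 * t.*2.+2 + (odd h * t.+1 + r).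
  by rewrite -{1}[h]odd_double_half; lia.
have lt_r : odd h * t.+1 + r < t.*2.+2 by case: odd; lia.
rewrite divnMDl // divn_small // modnMDl modn_small // addn0 edge_colourE //.
by rewrite uphalf_half; case: odd.
Qed.

Lemma walk_colour_sep h : wc (h * t.+1) = inl (sep (odd h)).
Proof. by rewrite -[_ * _]addn0 walk_colourE. Qed.

Lemma is_inl_walk_colour N : is_inl (wc N) = (t.+1 %| N).
Proof.
rewrite {1}(divn_eq N t.+1) walk_colourE; last by rewrite -ltnS ltn_pmod.
by rewrite /dvdn; case: (_ == 0).
Qed.

Lemma walk_colour_after q r : 0 < r <= t ->
  wc (q * t.*2.+2 + r) = inr (nth x0 (code (Phi q)) r.-1).
Proof.
move=> r_bd; have -> : q * t.*2.+2 + r = q.*2 * t.+1 + r by lia.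
rewrite walk_colourE; last lia.
by rewrite odd_double uphalf_double; case: r r_bd.
Qed.

Lemma walk_colour_before q r : 0 < r <= t ->
  wc (q.+1 * t.*2.+2 - r) = inr (nth x0 (code (Phi q.+1)) r.-1).
Proof.
move=> r_bd; have -> : q.+1 * t.*2.+2 - r = q.*2.+1 * t.+1 + (t.+1 - r) by lia.
rewrite walk_colourE; last lia.
have -> : (t.+1 - r == 0) = false by lia.
rewrite /= odd_double /= doubleK; congr (inr (nth _ _ _)); lia.
Qed.

Section Square.
Variables o s : nat.
Hypothesis s_gt0 : 0 < s.
Hypothesis sqr : forall N, o <= N < o + s -> wc N = wc (N + s).

Lemma square_dvd : t.+1 %| s.
Proof.
have dvd N : o <= N < o + 2 * s -> t.+1 %| N -> t.+1 %| s.
  move=> N_bd dvN; case: (ltnP N (o + s)) => [lt_N|ge_N].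
    have := is_inl_walk_colour N; rewrite sqr ?is_inl_walk_colour ?dvN; last lia.
    by rewrite dvdn_addr.
  have := is_inl_walk_colour (N - s); rewrite sqr; last lia.
  rewrite subnK; last lia.
  by rewrite is_inl_walk_colour dvN => /esym dvNs; rewrite -(dvdn_addr _ dvNs) subnK //; lia.
have lt_r := ltn_pmod o (ltn0Sn t); have := divn_eq o t.+1.
set h := o %/ t.+1; set r := o %% t.+1 in lt_r * => oE.
have [r0|r_gt0] := posnP r; first by apply: (dvd o); [lia|rewrite oE r0 addn0 dvdn_mull].
have [lt_h|ge_h] := ltnP (h.+1 * t.+1) (o + 2 * s).
  by apply: (dvd (h.+1 * t.+1)); [lia|rewrite dvdn_mull].
(* Without a separator the square lies inside one block, hence in a code word or its reversal. *)
have /squarefreeP-/(_ x0) sf := squarefree_code (Phi (uphalf h)).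
have letters l : l < s ->
    nth x0 (code (Phi (uphalf h))) (if odd h then t - (r + l) else (r + l).-1) =
    nth x0 (code (Phi (uphalf h))) (if odd h then t - (r + l + s) else (r + l + s).-1).
  move=> lt_ls; have := sqr (N := o + l) ltac:(lia).
  rewrite oE -!addnA !walk_colourE; try lia.
  have -> : (r + l == 0) = false by lia.
  have -> : (r + (l + s) == 0) = false by lia.
  by case.
case: (boolP (odd h)) letters => _ letters.
  case: (sf (t - (r + 2 * s).-1) s) => //; rewrite ?size_code; first lia.
  move=> l lt_ls; have := letters (s - l.+1) ltac:(lia).
  by move=> /esym; congr (nth _ _ _ = nth _ _ _); lia.
case: (sf r.-1 s) => //; rewrite ?size_code; first lia.
by move=> l lt_ls; have := letters l lt_ls; congr (nth _ _ _ = nth _ _ _); lia.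
Qed.

Lemma square_even c : s = c * t.+1 -> ~~ odd c.
Proof.
move=> sE; have c_gt0 : 0 < c by move: s_gt0; rewrite sE; case: c {sE}.
have le_ts : t.+1 <= s by rewrite sE; nia.
case: orient => [inj_sep|or].
  (* Rounding up, [h] is the first separator from [o] on. An odd shift flips its parity and so its
     colour. *)
  pose h := (o + t) %/ t.+1.
  have := divn_eq (o + t) t.+1; have := ltn_pmod (o + t) (ltn0Sn t).
  rewrite -/h => lt_r hE; have := sqr (N := h * t.+1) ltac:(lia).
  rewrite sE -mulnDl !walk_colour_sep => -[/inj_sep]; rewrite oddD.
  by case: (odd h); case: (odd c).
pose first a : nat := nth x0 (code a) 0; pose lst a : nat := nth x0 (code a) t.-1.
have lt_fl a : first a < lst a.
  by have := or a; rewrite /oriented -nth0 -nth_last size_code.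
have t_gt1 : 1 < t.
  case: (ltngtP t 1) => [|//|t1]; first lia.
  by have := lt_fl (Phi 0); rewrite /first /lst t1 ltnn.
pose val (x : S + 'I_n) : nat := if x is inr a then a else 0.
pose a h := Phi (uphalf h).
have wc1 h : val (wc (h * t.+1 + 1)) = if odd h then lst (a h) else first (a h).
  by rewrite walk_colourE //= /lst subn1; case: odd.
have wct h : val (wc (h * t.+1 + t)) = if odd h then first (a h) else lst (a h).
  by rewrite walk_colourE //= eqn0Ngt t_gt0 subnn /=; case: odd.
have sqv N : o <= N < o + s -> val (wc N) = val (wc (N + s)) by move/sqr->.
(* Block [h] is the first whose first letter is at [o] or later. An odd shift reverses the reading
   direction, so if both end letters of the block lie in the first half, matching them contradicts
   [lt_fl]. *)
apply/negP => odd_c; pose h := (o.-1 + t) %/ t.+1.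
have := divn_eq (o.-1 + t) t.+1; have := ltn_pmod (o.-1 + t) (ltn0Sn t).
rewrite -/h => lt_r hE.
have lt_ho : h * t.+1 < o + t.
  by case: (posnP o) => o0; [rewrite /h o0 divn_small|]; lia.
have eq1 := sqv (h * t.+1 + 1) ltac:(lia).
have [lt_h|ge_h] := ltnP (h * t.+1 + t) (o + s).
  have eqt := sqv (h * t.+1 + t) ltac:(lia).
  move: eq1 eqt; rewrite sE !(addnAC _ _ (c * _)) -mulnDl !wc1 !wct oddD odd_c addbT.
  by have := lt_fl (a h); have := lt_fl (a (h + c)); case: odd => /=; lia.
(* The first half now ends inside block [h], so [s < 2 * t]. It still contains the last letter of
   the previous block, and one of the two matched pairs compares both ends of the same word. *)
have c1 : c = 1 by nia.
have s1 : s = t.+1 by rewrite sE c1 mul1n.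
have [g hg] : exists g, h = g.+1 by exists h.-1; case: (h) ge_h => [|?]; lia.
rewrite hg in hE lt_ho ge_h eq1.
have eqt := sqv (g * t.+1 + t) ltac:(lia).
have E1 : g.+1 * t.+1 + 1 + s = g.+2 * t.+1 + 1 by lia.
have E2 : g * t.+1 + t + s = g.+1 * t.+1 + t by lia.
move: eq1 eqt; rewrite E1 E2 !wc1 !wct /= negbK.
case: (boolP (odd g)) => odd_g /=.
  have -> : a g.+1 = a g by rewrite /a; congr Phi; lia.
  by have := lt_fl (a g); lia.
have -> : a g.+2 = a g.+1 by rewrite /a; congr Phi; lia.
by have := lt_fl (a g.+1); lia.
Qed.

Lemma walk_square : exists2 L, s = L * t.*2.+2 &
  forall q, o <= q * t.*2.+2 < o + s -> Phi q = Phi (q + L).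
Proof.
have /dvdnP[c sE] := square_dvd; have even_c := square_even sE.
exists c./2; first by rewrite sE -{1}(even_halfK even_c); lia.
have {}sE : s = c./2 * t.*2.+2 by rewrite sE -{1}(even_halfK even_c); lia.
move: c./2 sE => {c even_c} L sE q q_bd.
have L_gt0 : 0 < L by move: s_gt0; rewrite sE; case: L {sE}.
apply/inj_code/(@eq_from_nth _ x0) => [|i]; first by rewrite !size_code.
rewrite size_code => lt_it.
have [lt_q|ge_q] := ltnP (q * t.*2.+2 + t) (o + s).
  have := sqr (N := q * t.*2.+2 + i.+1) ltac:(lia).
  rewrite sE addnAC -mulnDl !walk_colour_after; try lia.
  by case.
(* The word after the vertex leaves the first half; as that half has length at least [2 * t + 2],
   the word before the vertex lies inside it. *)
have le_Ls : t.*2.+2 <= s by rewrite sE; nia.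
have q_gt0 : 0 < q by case: q q_bd ge_q => [|q]; lia.
have := sqr (N := q * t.*2.+2 - i.+1) ltac:(lia).
have -> : q * t.*2.+2 - i.+1 + s = (q.-1 + L).+1 * t.*2.+2 - i.+1 by rewrite sE; nia.
rewrite -{1}(prednK q_gt0) !walk_colour_before; try lia.
by case; rewrite -addSn prednK.
Qed.

End Square.
End Walk.
End Colouring.

(** * Transfer of the colouring to the subdivision *)

Lemma onth_map_nth (T C : Type) (f : T -> C) x (p : seq T) i :
  i < size p -> onth (map f p) i = Some (f (nth x p i)).
Proof. by move=> lt_ip; rewrite onthE -map_comp (nth_map x). Qed.

Section SubdivisionColouring.
Variables (G : sgraph) (K S : Type) (n t : nat) (sep : bool -> S) (code : K -> seq 'I_n).
Variables (x0 : 'I_n) (phi : G -> K).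
Hypothesis t_gt0 : 0 < t.
Hypothesis size_code : forall a, size (code a) = t.
Hypothesis squarefree_code : forall a, squarefree (code a).
Hypothesis inj_code : injective code.
Hypothesis orient : injective sep \/ forall a, oriented x0 (code a).
Hypothesis phi_nonrep : nonrepetitive phi.

Definition subdiv_colour (x : subdivision G t.*2.+1) : S + 'I_n :=
  match x : subdiv_vertex G t.*2.+1 with
  | inl _ => inl (sep false)
  | inr (e, i) => edge_colour t sep code x0 (phi (val e).1) (phi (val e).2) i.+1
  end.

Lemma on_edge_colour v w j x : j <= t.*2.+1 -> on_edge v w j x ->
  subdiv_colour x = edge_colour t sep code x0 (phi v) (phi w) j.
Proof.
move=> le_j; case: x => [u|[e i]] /=.
  by case/orP=> /andP[/eqP j0 _]; [rewrite j0|lia].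
have lt_i := ltn_ord i.
case/orP=> /andP[/eqP -> /eqP ji] /=; first by rewrite ji.
by rewrite edge_colour_sym //; congr edge_colour; lia.
Qed.

Lemma subdiv_colour_nonrepetitive : nonrepetitive subdiv_colour.
Proof.
move=> p path_p [s [s_gt0 sz_p rep]].
have [V [o [le_o trp]]] := @is_path_traces G t.*2.+1 isT p path_p ltac:(lia).
have [x _] : exists x : subdivision G t.*2.+1, x \in p.
  by case: (p) sz_p => [|x q] /=; [lia|exists x; rewrite mem_head].
have colp i : i < size p ->
    subdiv_colour (nth x p i) = walk_colour t sep code x0 (phi \o V) (i + o).
  move=> lt_i; have [oe _] := trp i x lt_i; apply: on_edge_colour oe.
  by rewrite -ltnS ltn_pmod.
have sqr N : o <= N < o + s -> walk_colour t sep code x0 (phi \o V) N =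
    walk_colour t sep code x0 (phi \o V) (N + s).
  move=> N_bd; have := rep (N - o) ltac:(lia).
  rewrite !(onth_map_nth _ x); try lia.
  rewrite !colp; try lia.
  have -> : N - o + o = N by lia.
  have -> : s + (N - o) + o = N + s by lia.
  by case.
have [L sE sqV] := walk_square t_gt0 size_code squarefree_code inj_code orient s_gt0 sqr.
have L_gt0 : 0 < L by move: s_gt0; rewrite sE; case: (L).
(* [V q0] is the first original vertex on the path: [V 0] if the path starts there, [V 1] otherwise.
   The length [2 * s] leaves room for exactly [2 * L] original vertices. *)
pose q0 : nat := (0 < o)%N.
have pos q : q0 <= q < q0 + 2 * L -> o <= q * t.*2.+2 < o + 2 * s.
  by rewrite /q0 sE => q_bd; case: (posnP o) q_bd => /= [->|o_gt0]; nia.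
have nthV q : q0 <= q < q0 + 2 * L -> nth x p (q * t.*2.+2 - o) = inl (V q).
  move=> /pos q_bd; have [] := trp (q * t.*2.+2 - o) x ltac:(lia).
  rewrite subnK; last lia.
  by rewrite mulnK ?modnMl ?on_edge0 // => /eqP.
apply: (phi_nonrep (p := [seq V q | q <- iota q0 (2 * L)])).
  case/andP: path_p => Up _; apply/andP; split.
    rewrite map_inj_in_uniq ?iota_uniq // => q q'; rewrite !mem_iota => q_bd q'_bd eqV.
    have : nth x p (q * t.*2.+2 - o) == nth x p (q' * t.*2.+2 - o).
      by rewrite !nthV ?eqV.
    have := pos _ q_bd; have := pos _ q'_bd => ? ?.
    rewrite nth_uniq ?sz_p //; [move=> /eqP; nia|lia|lia].
  apply/(sortedP (V 0)) => i; rewrite size_map size_iota => lt_i.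
  rewrite !(nth_map 0) ?size_iota ?nth_iota; try lia.
  have i_bd : q0 <= q0 + i < q0 + 2 * L by lia.
  have i1_bd : q0 <= q0 + i.+1 < q0 + 2 * L by lia.
  have := pos _ i_bd; have := pos _ i1_bd => ? ?.
  have [_] := trp ((q0 + i) * t.*2.+2 - o) x ltac:(lia).
  rewrite subnK; last lia.
  by rewrite mulnK // addnS; apply; lia.
exists L; split=> // [|i lt_i]; first by rewrite size_map size_iota.
rewrite !(onth_map_nth _ (V 0)) ?size_map ?size_iota; try lia.
rewrite !(nth_map 0) ?size_iota ?nth_iota; try lia.
have -> : q0 + (L + i) = q0 + i + L by lia.
congr Some; apply: (sqV (q0 + i)).
have := pos (q0 + i) ltac:(lia); rewrite sE.
by rewrite /q0; case: (posnP o) => /= [->|o_gt0]; nia.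
Qed.

End SubdivisionColouring.

(** * Bounds on the nonrepetitive chromatic number *)

Lemma nonrepetitive_colourable (G : sgraph) (C : finType) (phi : G -> C) :
  nonrepetitive phi -> nonrep_colourable G #|C|.
Proof.
move=> nr; exists (enum_rank \o phi) => p pp [s [s_gt0 sz rep]].
apply: (nr p pp); exists s; split=> // i /rep.
by rewrite map_comp !(onth_map _ _ enum_rank) => /(inj_omap enum_rank_inj).
Qed.

Lemma nonrep_number_leq (G : sgraph) k : nonrep_colourable G k -> nonrep_number G <= k.
Proof. by rewrite /nonrep_number; case: ex_minnP => j _ min /asboolP /min. Qed.

Lemma nonrep_number_colourable (G : sgraph) : nonrep_colourable G (nonrep_number G).
Proof. by rewrite /nonrep_number; case: ex_minnP => j /asboolP. Qed.

Lemma subdivision_colourable (G : sgraph) (S : finType) (sep : bool -> S) k n t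
    (x0 : 'I_n) (c : seq (seq 'I_n)) : 0 < t -> nonrep_colourable G k ->
    uniq c -> k <= size c -> {subset c <= sfwords n t} ->
    injective sep \/ {in c, forall w, oriented x0 w} ->
  nonrep_colourable (subdivision G t.*2.+1) (#|S| + n).
Proof.
move=> t_gt0 [phi nr] Uc le_kc sub_c orc.
pose code (a : 'I_k) := nth [::] c a.
have code_in a : code a \in c by rewrite mem_nth // (leq_trans (ltn_ord a)).
have inj_code : injective code.
  move=> a b /eqP; rewrite nth_uniq ?(leq_trans (ltn_ord _)) // => /eqP.
  exact: val_inj.
have codeP a : size (code a) = t /\ squarefree (code a).
  by have := sub_c _ (code_in a); rewrite mem_sfwords => /andP[/eqP].
rewrite -[n in _ + n]card_ord -card_sum.
apply: nonrepetitive_colourable (subdiv_colour_nonrepetitive (sep := sep) (x0 := x0)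
  t_gt0 _ _ inj_code _ nr) => [a|a|]; try by case: (codeP a).
by case: orc => [|orc]; [left|right=> a; apply: orc].
Qed.

Lemma nonrep_number_subdivision_leq (G : sgraph) m t :
    1 < m -> 0 < t -> nonrep_number G <= m ^ t ->
  nonrep_number (subdivision G t.*2.+1) <= m + 3.
Proof.
move=> m_gt1 t_gt0 le_k; have colG := nonrep_number_colourable G.
apply: nonrep_number_leq; case: (leqP t m.+1) => [le_t|lt_t].
  have -> : m + 3 = #|{: bool}| + m.+1 by rewrite card_bool; lia.
  apply: (@subdivision_colourable G _ id _ _ _ ord0 (sfwords m.+1 t)) colG _ _ _ _ => //.
  - exact: sfwords_uniq.
  - by apply: leq_trans le_k (nsf_geq_short m_gt1 _); rewrite t_gt0.
  - by left; apply: inj_id.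
have -> : m + 3 = #|{: unit}| + m.+2 by rewrite card_unit; lia.
apply: (@subdivision_colourable G _ (fun=> tt) _ _ _ ord0
  [seq w <- sfwords m.+2 t | oriented ord0 w]) colG _ _ _ _ => //.
- exact: filter_uniq (sfwords_uniq _ _).
- by rewrite size_filter; apply: leq_trans le_k (count_oriented_geq_long m_gt1 _ lt_t).
- by move=> w; rewrite mem_filter => /andP[].
- by right=> w; rewrite mem_filter => /andP[].
Qed.

(** Two adjacent vertices of equal colour form a repetitively coloured path, so one colour leaves no
    edges. This covers [m <= 1], where the word counts do not apply. *)
Lemma nonrep_number_subdivision_edgeless (G : sgraph) d :
  0 < d -> nonrep_number G <= 1 -> nonrep_number (subdivision G d) <= 1.
Proof.
move=> d_gt0 le_k; have [phi nr] := nonrep_number_colourable G.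
apply: nonrep_number_leq; exists (fun=> ord0) => -[|x [|y p]] pp [s [s_gt0 sz _]];
  try by move: sz => /=; lia.
have /adj_on_edge[//|v [w [_ [vw _ _ _]]]] : adj x y by case/andP: pp => _ /andP[].
apply: (nr [:: v; w]).
  by rewrite /is_path /= inE vw !andbT; apply/eqP => evw; rewrite evw adj_irr in vw.
exists 1; split=> // -[|] // _ /=; congr Some; apply: ord_inj.
by have := ltn_ord (phi v); have := ltn_ord (phi w); lia.
Qed.

Import GRing.Theory Num.Theory Order.TTheory.
Local Open Scope ring_scope.

Lemma leq_natr_root (R : realType) (j k t : nat) :
  (0 < t)%N -> (j ^ t <= k)%N -> j%:R <= k%:R `^ t%:R^-1 :> R.
Proof.
move=> t_gt0 le_jk.
have -> : j%:R = (j ^ t)%:R `^ t%:R^-1 :> R.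
  rewrite natrX -powR_mulrn // -powRrM mulfV ?powRr1 //.
  by rewrite pnatr_eq0 -lt0n.
by apply: ge0_ler_powR; rewrite ?invr_ge0 ?nnegrE ?ler_nat.
Qed.

Theorem theorem93 (R : realType) (G : sgraph) (d : nat) :
  odd d -> (3 <= d)%N ->
  (nonrep_number (subdivision G d))%:R
    <= (nonrep_number G)%:R `^ (2 / (d%:R - 1)) + 4 :> R.
Proof.
move=> odd_d d_ge3; have [t dE] : exists t, d = t.*2.+1 by exists d./2; lia.
have t_gt0 : (0 < t)%N by lia.
rewrite {odd_d d_ge3}dE.
have -> : 2 / ((t.*2.+1)%:R - 1) = t%:R^-1 :> R.
  rewrite -[(t.*2.+1)%:R]natr1 addrK -muln2 natrM invfM mulrCA divff ?mulr1 //.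
  by rewrite pnatr_eq0.
have ex_m : exists m, (nonrep_number G <= m ^ t)%N.
  exists (nonrep_number G); rewrite -{1}[nonrep_number G]expn1.
  by case: nonrep_number => [|k] //; rewrite leq_pexp2l.
case: (ex_minnP ex_m) => m le_k min_m.
case: (leqP m 1) => [le_m1|m_gt1].
  have le_k1 : (nonrep_number G <= 1)%N.
    by apply: leq_trans le_k _; rewrite -(exp1n t) leq_exp2r.
  apply: le_trans (_ : 1%:R <= _).
    by rewrite ler_nat; apply: nonrep_number_subdivision_edgeless.
  apply: le_trans (_ : 4 <= _); first by rewrite ler_nat.
  by rewrite lerDr powR_ge0.
(* The 4 is the 3 of [m + 3] and the 1 lost in passing to [m.-1], whose [t]-th power is below
   [nonrep_number G] by minimality of [m]. *)
apply: le_trans (_ : m.-1%:R + 4 <= _).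
  rewrite -natrD ler_nat; have := nonrep_number_subdivision_leq m_gt1 t_gt0 le_k; lia.
rewrite lerD2r; apply: leq_natr_root => //.
by apply: ltnW; rewrite ltnNge; apply/negP => /min_m; lia.
Qed.
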